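(* Assume the following conjecture: ( * ) for every $m\ge 1$, every constellation in $\mathcal{G}(p_m)$ whose gaps sum to less than $2p_{m+1}$ and which has fewer than $p_{m+1}-1$ gaps occurs infinitely often as a constellation among primes. Let $g_n=p_{n+1}-p_n$. Then: (1) (Spikes) $\limsup_{n\to\infty} g_n/g_{n+1}=\infty$ and $\liminf_{n\to\infty} g_n/g_{n+1}=0$. (2) (Oscillation) There is no $n_0$ such that for all $k\ge 1$, $g_{n_0+2k-1}<g_{n_0+2k}$ and $g_{n_0+2k}>g_{n_0+2k+1}$. (3) (Superlinearity) For every $k\ge 1$ there are infinitely many $j$ with $g_j<g_{j+1}<\cdots<g_{j+k}$.
   Context: $p_i$ denotes the $i$-th prime ($p_1=2$), $\Pi_m=\prod_{i=1}^m p_i$, and $\Phi_m=\prod_{i=1}^m(p_i-1)$. The cycle of gaps $\mathcal{G}(p_m)=(g_{m,1},\ldots,g_{m,\Phi_m})$ is the sequence of differences between consecutive integers in $[1,\Pi_m+1]$ that are coprime to $\Pi_m$, in increasing order starting from $1$; it is regarded as a cycle, with indices extended periodically by $g_{m,i+\Phi_m}=g_{m,i}$. A constellation is a finite sequence $s=(a_1,\ldots,a_j)$ of positive integers (gaps); it is a constellation in $\mathcal{G}(p_m)$ if for some index $i$, $g_{m,i+l-1}=a_l$ for $l=1,\ldots,j$. It occurs infinitely often as a constellation among primes if for infinitely many $i$ the consecutive primes $p_i,p_{i+1},\ldots,p_{i+j}$ satisfy $p_{i+l}-p_{i+l-1}=a_l$ for $l=1,\ldots,j$. *)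

(* Defs.v *)
From HB Require Import structures.
From mathcomp Require Import all_boot all_order all_algebra.
From mathcomp Require Import all_classical all_reals all_analysis.

Set Implicit Arguments.
Unset Strict Implicit.
Unset Printing Implicit Defensive.

Local Open Scope nat_scope.
Local Open Scope classical_set_scope.

Lemma ex_prime_gt (n : nat) : exists q, (n < q) && prime q.
Proof. by case: (prime_above n) => q nq pq; exists q; rewrite nq pq. Qed.

Definition next_prime (n : nat) : nat := ex_minn (ex_prime_gt n).

(* Primes are numbered from 1, so nth_prime 1 = 2; nth_prime 0 = 0 is a
   placeholder.  It only enters prime_gap 0 and gap_ratio R 0, a single term
   that does not affect an upper or lower limit. *)
Definition nth_prime (i : nat) : nat := iter i next_prime 0.

Definition prime_gap (n : nat) : nat := nth_prime n.+1 - nth_prime n.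

Definition primorial (m : nat) : nat := \prod_(1 <= i < m.+1) nth_prime i.

Definition primorial_phi (m : nat) : nat :=
  \prod_(1 <= i < m.+1) (nth_prime i - 1).

Definition differences (s : seq nat) : seq nat :=
  if s is x :: s' then pairmap (fun a b => b - a) x s' else [::].

Definition coprime_gaps (N : nat) : seq nat :=
  differences [seq x <- iota 1 N.+1 | coprime x N].

Definition gap_cycle (m : nat) : seq nat := coprime_gaps (primorial m).

(* The gap g_{m,i}, for i >= 1, with the index extended periodically. *)
Definition cycle_gap (m i : nat) : nat :=
  nth 0 (gap_cycle m) ((i - 1) %% primorial_phi m).

(* A constellation (a_1, ..., a_j) is a list s of size j; as lists are indexed
   from 0, a_l is nth 0 s (l - 1). *)
Definition constellation (s : seq nat) : bool := all (fun a => 0 < a) s.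

Definition constellation_in_cycle (m : nat) (s : seq nat) : Prop :=
  constellation s /\
  exists i, 1 <= i /\
    forall l, 1 <= l <= size s -> cycle_gap m (i + l - 1) = nth 0 s (l - 1).

Definition occurs_infinitely_often (s : seq nat) : Prop :=
  infinite_set [set i | 1 <= i /\
    forall l, 1 <= l <= size s ->
      nth_prime (i + l) - nth_prime (i + l - 1) = nth 0 s (l - 1)].

Definition gap_ratio (R : realType) (n : nat) : \bar R :=
  ((prime_gap n)%:R / (prime_gap n.+1)%:R)%R%:E.

(* Main.v *)
(** By the Chinese remainder theorem every admissible pattern of integers is
    realised by a block of the cycle G(p_m) for some m: a private prime larger
    than the length H of the pattern strikes out each unwanted position, and
    the residues modulo all other primes are chosen so as to spare the wanted
    positions.  Since p_m > H, the size restrictions of the conjecture then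
    hold automatically.  A sequence of k gaps that are multiples of (k+1)! is
    admissible: a prime p <= k+1 sees a single residue class, and a prime
    p > k+1 cannot be covered by k+1 classes.  Spikes come from the gaps
    (6N, 6) and (6, 6N), increasing runs from (D, 2D, ..., (k+1)D), and an
    increasing run of three gaps contradicts oscillation. *)
Require Import Defs.
From HB Require Import structures.
From mathcomp Require Import all_boot all_order all_algebra.
From mathcomp Require Import all_classical all_reals all_analysis.
From mathcomp Require Import zify.

Import Order.POrderTheory GRing.Theory Num.Theory.

Local Open Scope nat_scope.
Local Open Scope classical_set_scope.

(** * Primes, primorials and simultaneous congruences *)

Lemma next_primeP n : n < next_prime n /\ prime (next_prime n).
Proof. by rewrite /next_prime; case: ex_minnP => q /andP[]. Qed.

Lemma nth_prime_prime i : 0 < i -> prime (nth_prime i).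
Proof. by case: i => // i _; case: (next_primeP (nth_prime i)). Qed.

Lemma nth_prime_ltS i : nth_prime i < nth_prime i.+1.
Proof. by case: (next_primeP (nth_prime i)). Qed.

Lemma nth_prime_lt : {homo nth_prime : i j / i < j}.
Proof. by apply: homo_ltn; [exact: ltn_trans | exact: nth_prime_ltS]. Qed.

Lemma leq_nth_prime i : i <= nth_prime i.
Proof. by elim: i => // i /leq_ltn_trans; apply; exact: nth_prime_ltS. Qed.

Lemma primorialS m : primorial m.+1 = primorial m * nth_prime m.+1.
Proof. by rewrite /primorial big_nat_recr. Qed.

Lemma primorial_phiS m :
  primorial_phi m.+1 = primorial_phi m * (nth_prime m.+1 - 1).
Proof. by rewrite /primorial_phi big_nat_recr. Qed.

Lemma coprime_primorial m y :
  coprime y (primorial m) = all (fun i => ~~ (nth_prime i %| y)) (iota 1 m).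
Proof.
elim: m => [|m IH]; first by rewrite /primorial big_geq // coprimen1.
have -> : iota 1 m.+1 = iota 1 m ++ [:: m.+1] by rewrite -(addn1 m) iotaD add1n addn1.
rewrite primorialS coprimeMr IH all_cat all_seq1.
by rewrite [coprime y (nth_prime _)]coprime_sym prime_coprime // nth_prime_prime.
Qed.

Lemma coprime_primorial_nth_prime m j :
  m < j -> coprime (primorial m) (nth_prime j).
Proof.
move=> mj; rewrite coprime_sym coprime_primorial; apply/allP => i.
rewrite mem_iota => /andP[i0 im]; have ij : i < j by lia.
rewrite dvdn_prime2 ?nth_prime_prime //; last by lia.
by rewrite ltn_eqF ?nth_prime_lt.
Qed.

Lemma primorial_gt0 m : 0 < primorial m.
Proof.
elim: m => [|m IH]; first by rewrite /primorial big_geq.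
by rewrite primorialS muln_gt0 IH prime_gt0 ?nth_prime_prime.
Qed.

Lemma totient_primorial m : totient (primorial m) = primorial_phi m.
Proof.
elim: m => [|m IH]; first by rewrite /primorial /primorial_phi !big_geq.
rewrite primorialS primorial_phiS totient_coprime ?coprime_primorial_nth_prime //.
by rewrite IH totient_prime ?nth_prime_prime // subn1.
Qed.

Lemma nth_prime_dvd_primorial i m : 0 < i <= m -> nth_prime i %| primorial m.
Proof.
elim: m => [|m IH]; first by lia.
rewrite primorialS => im; have [->|ne] := eqVneq i m.+1; first exact: dvdn_mull.
by apply: dvdn_mulr; apply: IH; lia.
Qed.

Lemma chinese_primorial m (r : nat -> nat) : exists x, x < primorial m /\
  forall i, 0 < i <= m -> x = r i %[mod nth_prime i].
Proof.
elim: m => [|m [x [_ xr]]].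
  by exists 0; split=> [|i]; [exact: primorial_gt0 | lia].
pose y := chinese (primorial m) (nth_prime m.+1) x (r m.+1).
have co := coprime_primorial_nth_prime m m.+1 (ltnSn m).
exists (y %% primorial m.+1); split; first by rewrite ltn_mod primorial_gt0.
move=> i im; rewrite modn_dvdm ?nth_prime_dvd_primorial //.
have [->|ne] := eqVneq i m.+1; first exact: chinese_modr.
have im' : 0 < i <= m by lia.
rewrite -xr // -(modn_dvdm y (nth_prime_dvd_primorial _ _ im')).
by rewrite /y chinese_modl // modn_dvdm ?nth_prime_dvd_primorial.
Qed.

Lemma dvdn_addl_mod q x r u : x = r %[mod q] -> (q %| x + u) = (q %| r + u).
Proof. by move=> e; rewrite /dvdn -modnDml e modnDml. Qed.

(** * Blocks with prescribed coprime positions *)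

(** Primes of index at most H + 1 spare [hs] by admissibility. Each later prime exceeds H + 1, so it
    strikes at most one position of the block, and its residue decides which. *)
Lemma exists_isolating_shift (H : nat) (hs : seq nat) :
    0 \in hs -> {in hs, forall h, h <= H} ->
    (forall p, prime p -> exists c, {in hs, forall h, ~~ (p %| c + h)}) ->
  exists m x, [/\ H < m, 0 < x, x + H < primorial m &
    forall u, u <= H -> coprime (x + u) (primorial m) = (u \in hs)].
Proof.
move=> hs0 hsH adm.
have [c cP] : exists c : nat -> nat,
    forall p, prime p -> {in hs, forall h, ~~ (p %| c p + h)}.
  have [p|c cP] := @choice _ _
      (fun p c => prime p -> {in hs, forall h, ~~ (p %| c + h)}).
    have [/adm[c cP]|_] := boolP (prime p); first by exists c.
    by exists 0.
  by exists c.
(* The prime of index H.+2 + u is the one that strikes out position u; the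
   last prime, of index m, has residue 1, so that no multiple of the primorial
   falls in the block: the block does not wrap around the cycle. *)
pose m := H.+2 + H.+1.
pose r i := if i < H.+2 then c (nth_prime i) else
  if (i < m) && (i - H.+2 \notin hs) then nth_prime i - (i - H.+2) else 1.
have [x [xlt xr]] := chinese_primorial m r.
have cop u : u <= H -> coprime (x + u) (primorial m) = (u \in hs).
  move=> uH; rewrite coprime_primorial; apply/allP/idP => [all_u|u_hs i].
    apply: contraT => u_hs.
    have im : 0 < H.+2 + u <= m by rewrite /m; lia.
    have := all_u (H.+2 + u); rewrite mem_iota => /(_ ltac:(lia)).
    rewrite (dvdn_addl_mod _ _ _ _ (xr _ im)) /r ifF ?addKn; last by lia.
    rewrite u_hs ifT; last by rewrite /m; lia.
    by rewrite subnK ?dvdnn //; have := leq_nth_prime (H.+2 + u); lia.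
  rewrite mem_iota => im; have {}im : 0 < i <= m by lia.
  rewrite (dvdn_addl_mod _ _ _ _ (xr _ im)) /r; case: ltnP => iH.
    by apply: cP => //; apply: nth_prime_prime; lia.
  have qi := leq_nth_prime i.
  (* Residue 1 strikes nothing, as 1 + u is less than the prime; a prime aimed at [i - H.+2] misses
     u, which differs from it by at most H. *)
  case: ifP => [/andP[im' v_hs]|_]; last by rewrite gtnNdvd //; lia.
  have /eqP ne : i - H.+2 != u by apply: contraNneq v_hs => ->.
  rewrite /m in im'; have [uv|vu] := ltnP u (i - H.+2).
    by rewrite gtnNdvd //; lia.
  have -> : nth_prime i - (i - H.+2) + u = nth_prime i + (u - (i - H.+2)) by lia.
  by rewrite dvdn_addr // gtnNdvd //; lia.
have no_multiple u : u <= H -> x + u != primorial m.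
  move=> uH; apply/eqP => e.
  have im : 0 < m <= m by rewrite /m; lia.
  have := nth_prime_dvd_primorial _ _ im.
  rewrite -e (dvdn_addl_mod _ _ _ _ (xr _ im)) /r ltnn ifF; last by rewrite /m; lia.
  by rewrite gtnNdvd //; have := leq_nth_prime m; rewrite /m; lia.
exists m, x; split=> //; first by rewrite /m; lia.
(* Position 0 is wanted, so x is odd. *)
- rewrite lt0n; apply/eqP => x0; have := cop 0 (leq0n _).
  rewrite hs0 x0 coprime_primorial => /allP/(_ 1).
  by rewrite mem_iota dvdn0 /m => /(_ ltac:(lia)).
- rewrite ltnNge; apply/negP => le.
  have /negP[] := no_multiple (primorial m - x) ltac:(lia).
  by apply/eqP; lia.
Qed.

(** * From coprime positions to the cycle of gaps *)

Lemma nth_differences (s : seq nat) i :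
  i.+1 < size s -> nth 0 (differences s) i = nth 0 s i.+1 - nth 0 s i.
Proof. by case: s => // x s i_s; rewrite /= (nth_pairmap 0). Qed.

Lemma size_differences s : size (differences s) = (size s).-1.
Proof. by case: s => // x s; rewrite /= size_pairmap. Qed.

Lemma size_coprime_filter N :
  size [seq x <- iota 1 N.+1 | coprime x N] = (totient N).+1.
Proof.
rewrite -(addn1 N) iotaD filter_cat size_cat add1n /= coprimeSn addn1.
congr _.+1; rewrite size_filter -sum1_count big_mkcond totient_count_coprime.
have -> : iota 1 N = index_iota 1 N.+1 by rewrite /index_iota subn1.
(* The totient counts over [0, N) and the filter over [1, N]; 0 and N have the same gcd with N, so
   the ends can be exchanged. *)
rewrite big_add1 /=; apply: (@addnI (coprime N 0)).
have -> : nat_of_bool (coprime N 0) = coprime N N.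
  by rewrite /coprime gcdn0 gcdnn.
rewrite [RHS]addnC -(@big_nat_recr _ _ _ _ _ (fun d => nat_of_bool (coprime N d))) //=.
rewrite big_nat_recl // {1 3}/coprime gcdnn gcdn0; congr (_ + _).
by apply: eq_bigr => i _; rewrite coprime_sym; case: coprime.
Qed.

(** The coprime integers split into those below x, the translate of [hs] by x, and those beyond x +
    H; the gaps of [hs] therefore start right after the first group. *)
Lemma constellation_in_cycleI (m : nat) (hs : seq nat) x H :
    sorted ltn hs -> {in hs, forall h, h <= H} ->
    0 < x -> x + H < primorial m ->
    (forall u, u <= H -> coprime (x + u) (primorial m) = (u \in hs)) ->
    constellation (differences hs) ->
  constellation_in_cycle m (differences hs).
Proof.
move=> hs_sorted hsH x0 xH cop cons; split=> //.
set N := primorial m in xH cop.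
pose L := [seq y <- iota 1 N.+1 | coprime y N].
pose A := [seq y <- iota 1 x.-1 | coprime y N].
pose B := [seq y <- iota (x + H.+1) (N.+1 - x - H) | coprime y N].
have LE : L = A ++ [seq x + h | h <- hs] ++ B.
  rewrite /L; have -> : N.+1 = x.-1 + (H.+1 + (N.+1 - x - H)) by lia.
  rewrite iotaD filter_cat; congr (_ ++ _).
  rewrite iotaD filter_cat; have -> : 1 + x.-1 = x by lia.
  congr (_ ++ _); rewrite -{1}[x]addn0 iotaDl filter_map; congr map.
  apply: (irr_sorted_eq ltn_trans ltnn) => //.
    exact: sorted_filter ltn_trans _ _ (iota_ltn_sorted _ _).
  move=> h; rewrite mem_filter mem_iota /=; apply/andP/idP => [[]|h_hs].
    by move=> c hH; rewrite -cop //; lia.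
  have hH := hsH _ h_hs; split; last by lia.
  by rewrite cop.
have sL : size L = (primorial_phi m).+1.
  by rewrite size_coprime_filter totient_primorial.
exists (size A).+1; split=> // l; rewrite size_differences => /andP[l0 ls].
have szs : size L = size A + (size hs + size B) by rewrite LE !size_cat size_map.
have nthL k : k < size hs -> nth 0 L (size A + k) = x + nth 0 hs k.
  move=> ks; rewrite LE nth_cat ifF; last by lia.
  by rewrite addKn nth_cat size_map ks (nth_map 0).
have -> : (size A).+1 + l - 1 = (size A + (l - 1)).+1 by lia.
(* The block ends inside [L], so the periodic index does not wrap. *)
rewrite /cycle_gap subn1 /= modn_small; last by lia.
rewrite /gap_cycle /coprime_gaps -/N -/L nth_differences; last by lia.
rewrite -addnS !nthL ?subnDl; try by lia.
by rewrite nth_differences //; lia.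
Qed.

(** * Admissibility of highly divisible gaps *)

Lemma path_ltn_scanl x s :
  constellation s -> path ltn x (scanl addn x s).
Proof.
by elim: s x => //= a s IH x /andP[a0 /IH ->]; rewrite andbT -[ltnLHS]addn0 ltn_add2l.
Qed.

Lemma mem_scanl_leq x s : {in scanl addn x s, forall h, h <= x + sumn s}.
Proof.
elim: s x => //= a s IH x h; rewrite inE addnA => /orP[/eqP ->|/IH //].
exact: leq_addr.
Qed.

Lemma mem_scanl_dvdn d x s :
  d %| x -> all (dvdn d) s -> {in scanl addn x s, forall h, d %| h}.
Proof.
elim: s x => //= a s IH x dx /andP[da ds] h.
have dxa : d %| x + a by rewrite dvdn_add.
by rewrite inE => /orP[/eqP -> //|/(IH _ dxa ds)].
Qed.

Lemma admissible_of_dvdn (hs : seq nat) : {in hs, forall h, (size hs)`! %| h} ->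
  forall p, prime p -> exists c, {in hs, forall h, ~~ (p %| c + h)}.
Proof.
move=> hsD p p_pr; have p0 := prime_gt0 p_pr.
have [ple|plt] := leqP p (size hs).
  exists 1 => h /hsD hD.
  have ph : p %| h by apply: dvdn_trans hD; rewrite dvdn_fact // p0.
  by rewrite (dvdn_addl _ ph) gtnNdvd ?prime_gt1.
(* Pigeonhole: the classes of -h for h in [hs] are fewer than p, so some class c is free. *)
pose bad := [seq (p - h %% p) %% p | h <- hs].
have /allPn[c cp cbad] : ~~ all (mem bad) (iota 0 p).
  apply/negP => /allP sub; have := uniq_leq_size (iota_uniq 0 p) sub.
  by rewrite size_iota size_map leqNgt plt.
exists c => h h_hs; apply: contra cbad => /= pch; apply/mapP; exists h => //.
have cp' : c < p by move: cp; rewrite mem_iota.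
rewrite -[LHS](modn_small cp'); apply/eqP; rewrite -(eqn_modDr (h %% p)).
by rewrite subnK ?modnn ?modnDmr // ltnW ?ltn_pmod.
Qed.

Lemma size_leq_sumn s : constellation s -> size s <= sumn s.
Proof. by elim: s => //= a s IH /andP[a0 /IH]; lia. Qed.

(** The conjecture assumed by the theorem, as a premise for the lemmas below. *)
Definition cycle_constellations_recur := forall (m : nat) (s : seq nat),
  1 <= m -> constellation_in_cycle m s ->
  sumn s < 2 * nth_prime m.+1 -> size s < nth_prime m.+1 - 1 ->
  occurs_infinitely_often s.

Lemma occurs_of_fact_dvdn s : cycle_constellations_recur ->
  constellation s -> all (dvdn (size s).+1`!) s -> occurs_infinitely_often s.
Proof.
(* The positions are the partial sums of s, one more than there are gaps; hence the factorial of
   [(size s).+1]. *)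
move=> conj s_pos sD; pose hs := 0 :: scanl addn 0 s.
have hsH : {in hs, forall h, h <= sumn s}.
  by move=> h; rewrite inE => /orP[/eqP -> //|/mem_scanl_leq].
have hsE : differences hs = s by rewrite /= scanlK // => a b; rewrite addKn.
have hsD : {in hs, forall h, (size hs)`! %| h}.
  move=> h; rewrite /= size_scanl inE => /orP[/eqP -> //|].
  exact: mem_scanl_dvdn.
have [m [x [Hm x0 xH cop]]] := exists_isolating_shift (sumn s) hs
  (mem_head _ _) hsH (admissible_of_dvdn hs hsD).
have pm := leq_nth_prime m.+1; have ss := size_leq_sumn s s_pos.
apply: (conj m); [lia | | lia | lia].
rewrite -hsE; apply: (constellation_in_cycleI m hs x (sumn s)) => //.
  exact: path_ltn_scanl.
by rewrite hsE.
Qed.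

(** * Infinite recurrence and upper and lower limits *)

Lemma infinite_set_unbounded (A : set nat) n :
  infinite_set A -> exists2 i, A i & n <= i.
Proof.
move=> Ainf; apply: contrapT => no; apply: Ainf.
apply: (@sub_finite_set _ _ `I_n) => // i Ai /=.
by rewrite ltnNge; apply/negP => ni; apply: no; exists i.
Qed.

Lemma constellation2_gaps a b n :
  occurs_infinitely_often [:: a; b] ->
  exists2 i, n <= i & prime_gap i = a /\ prime_gap i.+1 = b.
Proof.
move=> /(@infinite_set_unbounded _ n)[i [_ il] ni]; exists i => //.
split; first by have := il 1 isT; rewrite addn1 subn1.
by have := il 2 isT; rewrite addn2 subn1.
Qed.

Lemma limn_esup_pinfty (R : realType) (u : nat -> \bar R) :
    (forall n (N : nat), exists2 i, n <= i & (N%:R%:E <= u i)%E) ->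
  limn_esup u = +oo%E.
Proof.
move=> H; rewrite limn_esup_lim.
(* Every tail is unbounded, so the tail suprema are constant. *)
have -> : esups u = cst +oo%E; last by rewrite lim_cst.
apply/funext => n; apply/eqyP => A A0 /=.
have [i ni ui] := H n (Num.bound A).
apply: (@le_trans _ _ (u i)); last first.
  by apply: ereal_sup_ubound; exists i.
apply: le_trans ui; rewrite lee_fin.
by apply: ltW; apply: archi_boundP; apply: ltW.
Qed.

Lemma limn_einf_eq0 (R : realType) (u : nat -> \bar R) :
    (forall n, (0 <= u n)%E) ->
    (forall n (N : nat), exists2 i, n <= i & (u i <= (N.+1%:R^-1)%:E)%E) ->
  limn_einf u = 0%E.
Proof.
move=> u0 H; rewrite limn_einf_lim.
have -> : einfs u = cst 0%E; last by rewrite lim_cst.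
apply/funext => n /=; apply/le_anti/andP; split; last first.
  by apply: le_ereal_inf_tmp => _ [i _ <-].
apply/lee_addgt0Pr => e e0; rewrite add0e.
have [i ni ui] := H n (Num.bound e^-1).
apply: (@le_trans _ _ (u i)).
  by apply: ereal_inf_lbound; exists i.
apply: (le_trans ui); rewrite lee_fin.
rewrite -[leRHS]invrK lef_pV2 ?posrE ?invr_gt0 ?ltr0n //.
apply: (@le_trans _ _ (Num.bound e^-1)%:R%R).
  apply: ltW; apply: archi_boundP.
  by rewrite invr_ge0 ltW.
by rewrite ler_nat.
Qed.

(** * Increasing runs, spikes and oscillation *)

Lemma increasing_gaps_recur k : cycle_constellations_recur ->
  infinite_set [set j | 1 <= j /\
    forall i, i < k -> prime_gap (j + i) < prime_gap (j + i + 1)].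
Proof.
(* k comparisons involve k + 1 gaps, hence k + 2 positions. *)
move=> conj; pose D := k.+2`!; pose s := [seq D * i | i <- iota 1 k.+1].
have D0 : 0 < D := fact_gt0 _.
have ss : size s = k.+1 by rewrite size_map size_iota.
have nth_s i : i < k.+1 -> nth 0 s i = D * i.+1.
  by move=> ik; rewrite (nth_map 0) ?size_iota // nth_iota // add1n.
have : occurs_infinitely_often s.
  apply: occurs_of_fact_dvdn => //.
    by apply/allP => _ /mapP[i + ->]; rewrite mem_iota muln_gt0 D0 => /andP[].
  by apply/allP => _ /mapP[i _ ->]; rewrite ss dvdn_mulr.
apply: sub_infinite_set => j [j1 jl]; split=> // i ik.
have gap l : l < k.+1 -> prime_gap (j + l) = D * l.+1.
  move=> lk; rewrite -nth_s // -[l in RHS](subn1 l.+1) -jl; last by rewrite ss.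
  by rewrite addnS subn1.
by rewrite -addnA !gap ?ltn_pmul2l; lia.
Qed.

Theorem mainTheorem4 (R : realType)
    (conj : forall (m : nat) (s : seq nat), 1 <= m ->
       constellation_in_cycle m s ->
       sumn s < 2 * nth_prime m.+1 ->
       size s < nth_prime m.+1 - 1 ->
       occurs_infinitely_often s) :
  (limn_esup (gap_ratio R) = +oo%E /\ limn_einf (gap_ratio R) = 0%E) /\
  (~ exists n0 : nat, forall k : nat, 1 <= k ->
       prime_gap (n0 + 2 * k - 1) < prime_gap (n0 + 2 * k) /\
       prime_gap (n0 + 2 * k) > prime_gap (n0 + 2 * k + 1)) /\
  (forall k : nat, 1 <= k ->
     infinite_set [set j | 1 <= j /\
       forall i, i < k -> prime_gap (j + i) < prime_gap (j + i + 1)]).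
Proof.
(* Two gaps have three positions, and 6 = 3!. *)
have gaps a b n : 0 < a -> 0 < b -> 6 %| a -> 6 %| b ->
    exists2 i, n <= i & prime_gap i = a /\ prime_gap i.+1 = b.
  move=> a0 b0 a6 b6; apply: constellation2_gaps.
  by apply: occurs_of_fact_dvdn => //; apply/and3P; split.
have natr6 : (6%:R != 0 :> R)%R by rewrite pnatr_eq0.
split; [split|split=> [[n0 osc]|k _]].
- apply: limn_esup_pinfty => n N.
  have [//|//|||i ni [gi gi1]] := gaps (6 * N.+1) 6 n; rewrite ?dvdn_mulr //.
  exists i => //; rewrite /gap_ratio gi gi1 lee_fin natrM mulrC.
  by rewrite mulKf // ler_nat.
- apply: limn_einf_eq0 => [n|n N].
    by rewrite lee_fin divr_ge0 ?ler0n.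
  have [//|//|||i ni [gi gi1]] := gaps 6 (6 * N.+1) n; rewrite ?dvdn_mulr //.
  exists i => //; rewrite /gap_ratio gi gi1 lee_fin natrM.
  by rewrite invfM mulrA divff // mul1r.
- have [j [_ inc] jn] :=
    infinite_set_unbounded _ n0.+1 (increasing_gaps_recur 2 conj).
  have := inc 0 isT; have := inc 1 isT; rewrite addn0 -addnA => lt12 lt01.
  (* One of j and j + 1 has the parity of [n0]; oscillation demands a descent there, but the run
     rises. The bound [jn] makes the index k at least 1. *)
  have [jo|je] := boolP (odd (j - n0)).
  + have [_] := osc ((j - n0).+1./2) ltac:(lia).
    have -> : n0 + 2 * (j - n0).+1./2 = j + 1 by lia.
    by rewrite -addnA; lia.
  + have [_] := osc ((j - n0)./2) ltac:(lia).
    have -> : n0 + 2 * (j - n0)./2 = j by lia.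
    by lia.
- exact: increasing_gaps_recur.
Qed.
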